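(* Let $\mathcal{A}$ be a triangular UHF algebra. Then $\mathcal{A}$ is a zero Lie product determined Banach algebra.
   Context: Let $\{p_n\}$ be a sequence of positive integers with $p_m\mid p_n$ whenever $m\le n$. For each $n$ let $\mathcal{T}_{p_n}$ be the algebra of all $p_n\times p_n$ upper triangular complex matrices (with the operator norm), and for $m\le n$ let $\sigma_{p_n,p_m}:\mathcal{T}_{p_m}\to\mathcal{T}_{p_n}$, $\sigma_{p_n,p_m}(x)=I_d\otimes x$ with $d=p_n/p_m$. A triangular UHF algebra is a Banach algebra isometrically isomorphic to the Banach algebra inductive limit $\varinjlim(\mathcal{T}_{p_n};\sigma_{p_n,p_m})$ for some such sequence. A Banach algebra $\mathcal{A}$ is zero Lie product determined if for every continuous bilinear functional $\phi$ on $\mathcal{A}\times\mathcal{A}$ satisfying $\phi(x,y)=0$ whenever $x$ and $y$ commute, there is a (not necessarily continuous) linear functional $\tau$ on $[\mathcal{A},\mathcal{A}]$ with $\phi(x,y)=\tau([x,y])$ for all $x,y\in\mathcal{A}$; here $[x,y]=xy-yx$ and $[\mathcal{A},\mathcal{A}]$ is the linear span of all commutators of $\mathcal{A}$. *)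

(* Defs.v *)
From HB Require Import structures.
From mathcomp Require Import all_boot all_order all_algebra.
From mathcomp Require Import all_classical all_reals all_analysis.
From mathcomp Require Import complex mxtens.

Set Implicit Arguments.
Unset Strict Implicit.
Unset Printing Implicit Defensive.

Import Order.TTheory GRing.Theory Num.Theory.
Import numFieldNormedType.Exports.

Local Open Scope classical_set_scope.
Local Open Scope ring_scope.

(* R[i] packed as a numClosedFieldType: the norm topology of MathComp-Analysis
   is attached to the sorts of abstract number fields, so it is found for
   [Cplx R] and not for the bare [R[i]]. *)
Definition Cplx (R : realType) : numClosedFieldType := R[i].

(* The product is a field of its own, rather than that of a [GRing.Algebra],
   because Hierarchy Builder rejects a join of [NormedModule] with a ring
   structure outside [Num.NumDomain]. A unit element is not required. *)
HB.mixin Record hasBanachProduct (K : numFieldType) A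
    & CompleteNormedModule K A := {
  bmul : A -> A -> A;
  bmulA : associative bmul;
  bmulDl : left_distributive bmul +%R;
  bmulDr : right_distributive bmul +%R;
  bscaleAl : forall (a : K) (x y : A), a *: bmul x y = bmul (a *: x) y;
  bscaleAr : forall (a : K) (x y : A), a *: bmul x y = bmul x (a *: y);
  normr_bmul_le : forall x y : A, `|bmul x y| <= `|x| * `|y|
}.

#[short(type="banachAlgType")]
HB.structure Definition BanachAlgebra (K : numFieldType) :=
  {A of CompleteNormedModule K A & hasBanachProduct K A}.

Notation "x *b y" := (bmul x y) (at level 40, left associativity) : ring_scope.

Definition isometrically_isomorphic (K : numFieldType)
    (A B : banachAlgType K) : Prop :=
  exists f : {linear A -> B},
    [/\ bijective f,
        forall x y, f (x *b y) = f x *b f y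
      & forall x, `|f x| = `|x|].

Section ZeroLieProductDetermined.
Variables (K : numFieldType) (A : banachAlgType K).

Definition commutator (x y : A) : A := x *b y - y *b x.

Definition commutator_span : set A :=
  [set z | exists (n : nat) (a : 'I_n -> K) (x y : 'I_n -> A),
     z = \sum_(i < n) a i *: commutator (x i) (y i)].

(* A linear functional on the subspace S, as the restriction to S of a function
   on A whose values outside S are irrelevant. *)
Definition linear_functional_on (S : set A) (tau : A -> K) : Prop :=
  forall (a : K) (x y : A), S x -> S y ->
    tau (a *: x + y) = a * tau x + tau y.

Definition zero_Lie_product_determined : Prop :=
  forall phi : {biscalar A},
    continuous (fun z : A * A => phi z.1 z.2 : K) ->
    (forall x y : A, x *b y = y *b x -> phi x y = 0) ->
    exists tau : A -> K,
      linear_functional_on commutator_span tau /\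
      forall x y : A, phi x y = tau (commutator x y).

End ZeroLieProductDetermined.

Section TriangularUHF.
Variable R : realType.
Let C := Cplx R.

(* [is_trig_mx] means lower triangular. *)
Definition upper_trig (n : nat) (x : 'M[C]_n) : bool := is_trig_mx x^T.

Definition l2norm (n : nat) (v : 'cV[C]_n) : R :=
  Num.sqrt (\sum_i ((complex.Re (v i 0)) ^+ 2 + (complex.Im (v i 0)) ^+ 2)).

(* Not the canonical norm of MathComp-Analysis on matrices, which is the
   maximum of the norms of the entries. *)
Definition opnorm (n : nat) (x : 'M[C]_n) : R :=
  sup [set l2norm (x *m v) | v in [set v : 'cV[C]_n | l2norm v <= 1]].

Definition sigma (q p : nat) (dvd_pq : (p %| q)%N) (x : 'M[C]_p) : 'M[C]_q :=
  castmx (divnK dvd_pq, divnK dvd_pq) (tensmx (1%:M : 'M[C]_(q %/ p)) x).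

(* The inductive limit is the completion of the algebraic direct limit of the
   T_(p n) for the seminorm |[x]_n| = lim_m |sigma_(p m, p n) x|. Accordingly L
   is that completion when the algebraic direct limit maps into L by a
   homomorphism with dense range that preserves this seminorm. The homomorphism
   is given by its components [iota n] on T_(p n); these are total functions on
   matrices whose values off the upper triangular matrices are irrelevant. *)
Definition is_inductive_limit (p : nat -> nat)
    (dvd_p : forall m n, (m <= n)%N -> (p m %| p n)%N)
    (L : banachAlgType C) : Prop :=
  exists iota : forall n, 'M[C]_(p n) -> L,
    [/\ forall n (a : C) (x y : 'M[C]_(p n)), upper_trig x -> upper_trig y ->
          iota n (a *: x + y) = a *: iota n x + iota n y /\
          iota n (x *m y) = iota n x *b iota n y,
        forall m n (le_mn : (m <= n)%N) (x : 'M[C]_(p m)), upper_trig x ->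
          iota n (sigma (dvd_p m n le_mn) x) = iota m x,
        forall n (x : 'M[C]_(p n)), upper_trig x ->
          (fun k => opnorm (sigma (dvd_p n (n + k)%N (leq_addr k n)) x)) @ \oo
            --> complex.Re `|iota n x|
      & dense [set a : L | exists n (x : 'M[C]_(p n)),
                 upper_trig x /\ a = iota n x]].

Definition triangular_UHF (A : banachAlgType C) : Prop :=
  exists (p : nat -> nat)
         (dvd_p : forall m n, (m <= n)%N -> (p m %| p n)%N)
         (L : banachAlgType C),
    [/\ forall n, (0 < p n)%N,
        is_inductive_limit dvd_p L
      & isometrically_isomorphic L A].

End TriangularUHF.

(* Main.v *)
Require Import Defs.
From HB Require Import structures.
From mathcomp Require Import all_boot all_order all_algebra.
From mathcomp Require Import all_classical all_reals all_analysis.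
From mathcomp Require Import complex mxtens ring.

Set Implicit Arguments.
Unset Strict Implicit.
Unset Printing Implicit Defensive.

Import Order.TTheory GRing.Theory Num.Theory.
Import numFieldNormedType.Exports.

Local Open Scope classical_set_scope.
Local Open Scope ring_scope.

(** Let [phi] be a continuous bilinear functional that vanishes on commuting
    pairs, with [|phi x y| <= M |x| |y|].  The heart of the proof is the
    estimate
      [|sum_i a_i phi(x_i, y_i)| <= M |sum_i a_i [x_i, y_i]|].
    It makes the value of [sum_i a_i phi(x_i, y_i)] depend only on the element
    [sum_i a_i [x_i, y_i]], and so it yields the functional [tau]
    ([functional_of_commutator_bound]).

    Both sides of the estimate are continuous in the [x_i] and [y_i], and the
    images of the algebras T_(p n) form an increasing sequence with dense union.
    So it suffices to treat elements of one of these images, that is, of the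
    linear span of elements [E i j], [i <= j], that multiply like the matrix
    units [e_ij].  Comparing [phi] on pairs of units, by means of well chosen
    commuting pairs, gives
      [phi(x, y) = t([x, y])]  with  [t(z) = sum_k phi(e_kk, e_kk z)]
    on that span ([phi_span_commutator]).

    The point is then that [|t(z)| <= M |z|], with a constant that does not grow
    with the size of the matrices.  Indeed [t(z)] is the average of
    [phi(s, s z)] over the diagonal matrices [s] with entries [1] and [-1]: the
    mixed terms [phi(e_kk, e_ll z)] cancel because the signs of different
    entries are independent ([norm_diag_le_sign_sums]).  Each such [s] has norm
    at most 1, since it stays a diagonal sign matrix in all the later algebras
    of the inductive system and such a matrix preserves the Euclidean norm.  By
    submultiplicativity each [phi(s, s z)] is therefore at most [M |z|]
    ([norm_diagonal_trace_le]). *)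

(** * Bilinear maps on Banach algebras *)

Section BilinearMaps.
Variables (K : numFieldType) (A : banachAlgType K).

Lemma bmul_is_bilinear : bilinear_for
  (GRing.Scale.Law.clone _ _ *:%R _) (GRing.Scale.Law.clone _ _ *:%R _)
  (@bmul K A).
Proof.
split=> [z|z] a x y /=; first by rewrite bmulDl bscaleAl.
by rewrite bmulDr bscaleAr.
Qed.

HB.instance Definition _ :=
  bilinear_isBilinear.Build K A A A _ _ (@bmul K A) bmul_is_bilinear.

Lemma commutator_is_bilinear : bilinear_for
  (GRing.Scale.Law.clone _ _ *:%R _) (GRing.Scale.Law.clone _ _ *:%R _)
  (@commutator K A).
Proof.
split=> [z|z] a x y /=; rewrite /commutator linearDl linearDr
  linearZl_LR linearZr_LR /=.
  by rewrite scalerBr opprD addrACA.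
by rewrite scalerBr opprD addrACA.
Qed.

HB.instance Definition _ :=
  bilinear_isBilinear.Build K A A A _ _ (@commutator K A)
    commutator_is_bilinear.

End BilinearMaps.

(** The homogeneity step that turns a bound on a ball of radius [e] into a global
    one: [t] is the value of a bilinear form at vectors of norms [a] and [b],
    which are rescaled to norm [e]. *)
Lemma norm_le_of_rescaled (K : numFieldType) (e a b t : K) :
  0 < e -> 0 < a -> 0 < b ->
  `|e / a * (e / b * t)| <= 1 -> `|t| <= e^-1 ^+ 2 * (a * b).
Proof.
move=> e0 a0 b0; rewrite !normrM !normfV.
rewrite !(gtr0_norm e0) (gtr0_norm a0) (gtr0_norm b0) => H.
rewrite -(ler_pM2l (_ : 0 < e / a * (e / b))); last first.
  by rewrite mulr_gt0// divr_gt0.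
rewrite (_ : _ * (_ * (a * b)) = 1); first by rewrite -(mulrA (e / a)).
by field; rewrite !lt0r_neq0.
Qed.

Section BilinearTopology.
Variables (K : numFieldType) (U : normedModType K).

Lemma continuous_biscalar_bounded (phi : {biscalar U}) :
  continuous (fun z : U * U => phi z.1 z.2 : K) ->
  exists2 M, 0 <= M & forall x y, `|phi x y| <= M * (`|x| * `|y|).
Proof.
move=> /(_ (0, 0)) /cvgr_dist_lt /(_ 1 ltr01) /=; rewrite linear0l.
move=> /nbhs_ballP[d /= d0 dP].
pose e := d / 2; have e0 : 0 < e by rewrite divr_gt0.
have eP u v : `|u| <= e -> `|v| <= e -> `|phi u v| <= 1.
  move=> ue ve; apply: ltW; have := dP (u, v); rewrite /= sub0r normrN.
  apply; split; rewrite /= -ball_normE /= sub0r normrN.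
    by rewrite (le_lt_trans ue)// /e ltr_pdivrMr// ltr_pMr// ltr1n.
  by rewrite (le_lt_trans ve)// /e ltr_pdivrMr// ltr_pMr// ltr1n.
exists (e^-1 ^+ 2) => [|x y]; first by rewrite exprn_ge0// invr_ge0 ltW.
have [->|x0] := eqVneq x 0; first by rewrite linear0l !normr0 mul0r mulr0.
have [->|y0] := eqVneq y 0; first by rewrite linear0r !normr0 mulr0 mulr0.
have nP (z : U) : z != 0 -> `| (e / `|z|) *: z| <= e.
  move=> z0; rewrite normrZ normrM normfV normr_id (gtr0_norm e0).
  by rewrite mulfVK// normr_eq0.
have := eP _ _ (nP x x0) (nP y y0).
rewrite linearZl_LR linearZr_LR /=.
by apply: norm_le_of_rescaled => //; rewrite normr_gt0.
Qed.

Variables (V W : normedModType K).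

(** The scaling laws [s] and [s'] are arbitrary so that one statement covers both
    scalar-valued forms and the commutator of an algebra. *)
Lemma bounded_bilinear_cvg (s s' : K -> W -> W)
    (f : {bilinear U -> V -> W | s & s'}) (M : K) T (F : set_system T)
    (FF : Filter F) (u : T -> U) (v : T -> V) (x : U) (y : V) :
  0 <= M -> (forall x y, `|f x y| <= M * (`|x| * `|y|)) ->
  u t @[t --> F] --> x -> v t @[t --> F] --> y ->
  f (u t) (v t) @[t --> F] --> f x y.
Proof.
move=> M0 fM ux vy; apply/cvgrPdist_le => e e0.
(* The summand [e] in the denominator of [d] keeps [d <= 1], so that [u k] stays
   within distance 1 of [x], and [d] defined even when [M = 0]. *)
pose c := M * (`|x| + `|y| + 1).
have c0 : 0 <= c by rewrite mulr_ge0// !addr_ge0.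
pose d := e / (e + c).
have ec0 : 0 < e + c by rewrite ltr_pwDl.
have d0 : 0 < d by rewrite divr_gt0.
have d1 : d <= 1 by rewrite ler_pdivrMr// mul1r lerDl.
have cd : c * d <= e.
  rewrite mulrA ler_pdivrMr// mulrC mulrDr lerDr mulr_ge0 ?ltW//.
near=> k.
have xu : `|x - u k| <= d by near: k; apply: cvgr_dist_le.
have yv : `|y - v k| <= d by near: k; apply: cvgr_dist_le.
have -> : f x y - f (u k) (v k) = f (x - u k) y + f (u k) (y - v k).
  by rewrite linearBl linearBr addrA subrK.
apply: le_trans (ler_normD _ _) _; apply: le_trans cd.
have uk : `|u k| <= `|x| + 1.
  have -> : u k = x - (x - u k) by rewrite subKr.
  by apply: le_trans (ler_normB _ _) _; rewrite lerD2l (le_trans xu).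
apply: le_trans (lerD (fM _ _) (fM _ _)) _.
rewrite -mulrDr /c -mulrA ler_wpM2l//.
have -> : (`|x| + `|y| + 1) * d = d * `|y| + (`|x| + 1) * d by ring.
by rewrite lerD// ?ler_pM// ler_wpM2r.
Unshelve. all: by end_near. Qed.

Lemma cvg_norm_le (M : K) T (F : set_system T) (FF : ProperFilter F)
    (u : T -> V) (v : T -> W) (x : V) (y : W) :
  0 <= M -> (forall t, `|u t| <= M * `|v t|) ->
  u t @[t --> F] --> x -> v t @[t --> F] --> y -> `|x| <= M * `|y|.
Proof.
move=> M0 uv ux vy; apply/ler_addgt0Pr => e e0.
have M1 : 0 < M + 1 by rewrite ltr_wpDl.
have d0 : 0 < e / (M + 1) by rewrite divr_gt0.
have [t [xu yv]] : exists t, `|x - u t| <= e / (M + 1) /\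
    `|y - v t| <= e / (M + 1).
  by apply: (@filter_ex _ F); apply: filterI; exact: cvgr_dist_le.
have -> : x = (x - u t) + u t by rewrite subrK.
apply: le_trans (ler_normD _ _) _.
have vt : `|v t| <= `|y| + e / (M + 1).
  have -> : v t = y - (y - v t) by rewrite subKr.
  by apply: le_trans (ler_normB _ _) _; rewrite lerD2l.
apply: le_trans (lerD xu (le_trans (uv t) (ler_wpM2l M0 vt))) _.
have -> : e / (M + 1) + M * (`|y| + e / (M + 1)) = M * `|y| + e.
  by field; rewrite lt0r_neq0.
by [].
Qed.

End BilinearTopology.

(** * Averaging over signs *)

Section SignAverage.
Variables (K : numFieldType) (U : lmodType K) (B : {biscalar U}).

Lemma le_norm_half_sum (a b M : K) :
  `|a| <= M -> `|b| <= M -> `|(a + b) / 2| <= M.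
Proof.
move=> aM bM; rewrite normrM normfV normr_nat ler_pdivrMr// mulr2n mulrDr mulr1.
by apply: le_trans (ler_normD _ _) _; rewrite lerD.
Qed.

(** The number inside the norm of the conclusion is the average over all [s] of
    the numbers inside the norm of the hypothesis, since the average of
    [(-1)^(s k) (-1)^(s l)] is 0 for [k != l], and that of [(-1)^(s k)] is 0.
    The average is taken one sign at a time; [a], [b] and [c] collect what the
    remaining induction must carry along. *)
Lemma norm_diag_le_sign_sums (M : K) n (u v : 'I_n -> U) (a b : U) (c : K) :
  (forall s : 'I_n -> bool,
     `|c + B (a + \sum_k (-1) ^+ s k *: u k)
             (b + \sum_k (-1) ^+ s k *: v k)| <= M) ->
  `|c + B a b + \sum_k B (u k) (v k)| <= M.
Proof.
elim: n => [|n IHn] in u v a b c *.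
  by move=> /(_ (fun=> true)); rewrite !big_ord0 !addr0.
move=> H; rewrite big_ord_recl addrA -(addrA c) (addrC (B a b)) addrA.
apply: IHn => s.
(* The sign [b0] at index 0, then the signs [s]; the two choices of [b0] are
   averaged. *)
pose s_ b0 (i : 'I_n.+1) := if unlift ord0 i is Some j then s j else b0.
have s_lift b0 j : s_ b0 (lift ord0 j) = s j by rewrite /s_ liftK.
have s_0 b0 : s_ b0 ord0 = b0 by rewrite /s_ unlift_none.
have := le_norm_half_sum (H (s_ false)) (H (s_ true)).
rewrite !big_ord_recl !s_0 expr0 expr1 !scale1r !scaleN1r.
under eq_bigr do rewrite s_lift.
under [X in B _ (b + (_ + X))]eq_bigr do rewrite s_lift.
under [X in B (a + (- _ + X))]eq_bigr do rewrite s_lift.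
under [X in B _ (b + (- _ + X))]eq_bigr do rewrite s_lift.
set S := \sum_ _ _ ; set T := \sum_ _ _.
congr (`|_| <= _).
rewrite !(linearDl, linearDr, linearNl, linearNr) /=.
by field.
Qed.

End SignAverage.

(** * Systems of upper triangular matrix units *)

Section TriangularUnits.
Variables (K : numFieldType) (A : banachAlgType K).

(** Only the [E i j] with [i <= j] are meaningful: these are the matrix units of
    an upper triangular matrix algebra, realised inside [A]. *)
Definition triangular_units n (E : 'I_n -> 'I_n -> A) : Prop :=
  forall i j k l : 'I_n, (i <= j)%N -> (k <= l)%N ->
    E i j *b E k l = if j == k then E i l else 0.

Definition contractive_signs n (E : 'I_n -> 'I_n -> A) : Prop :=
  forall s : 'I_n -> bool, `|\sum_k (-1) ^+ s k *: E k k| <= 1.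

Definition triangular_span n (E : 'I_n -> 'I_n -> A) : set A :=
  [set x | exists a : 'I_n -> 'I_n -> K,
     x = \sum_(i < n) \sum_(j < n | (i <= j)%N) a i j *: E i j].

Variables (n : nat) (E : 'I_n -> 'I_n -> A).

Lemma bilinear_eq0_triangular_span (g : A -> A -> K) :
  (forall y a x x', g (a *: x + x') y = a * g x y + g x' y) ->
  (forall x a y y', g x (a *: y + y') = a * g x y + g x y') ->
  (forall i j k l : 'I_n, (i <= j)%N -> (k <= l)%N -> g (E i j) (E k l) = 0) ->
  forall x y, triangular_span E x -> triangular_span E y -> g x y = 0.
Proof.
have span_eq0 (h : A -> K) : (forall a x x', h (a *: x + x') = a * h x + h x') ->
    (forall i j : 'I_n, (i <= j)%N -> h (E i j) = 0) ->
    forall x, triangular_span E x -> h x = 0.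
  move=> hP hE x [a ->].
  have h0 : h 0 = 0 by rewrite -(addNr 0) -scaleN1r hP mulN1r addNr.
  have hD u v : h u = 0 -> h v = 0 -> h (u + v) = 0.
    by move=> u0 v0; rewrite -[u]scale1r hP u0 v0 mulr0 addr0.
  apply: (big_ind (fun z => h z = 0)) => // i _.
  apply: (big_ind (fun z => h z = 0)) => // j ij.
  by rewrite -[_ *: _]addr0 hP h0 hE// mulr0 addr0.
move=> gl gr gE x y xE yE; apply: (span_eq0 (g^~ y)) => // i j ij.
by apply: (span_eq0 (g (E i j))) => // k l kl; exact: gE.
Qed.

Hypothesis EM : triangular_units E.
Variable phi : {biscalar A}.
Hypothesis phi0 : forall x y : A, x *b y = y *b x -> phi x y = 0.

(** A functional that represents [phi] on commutators.  On a commutator only the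
    values at the [e_ij] with [i < j] matter, and there [phi (e_ii, e_ij)] is
    forced by [e_ij = [e_ii, e_ij]].  Summing over [k] makes it the diagonal part
    of a sum that can be bounded by averaging over signs. *)
Definition diagonal_trace (z : A) : K := \sum_k phi (E k k) (E k k *b z).

Lemma diagonal_trace_linear a x y :
  diagonal_trace (a *: x + y) = a * diagonal_trace x + diagonal_trace y.
Proof.
rewrite /diagonal_trace mulr_sumr -big_split; apply: eq_bigr => k _ /=.
by rewrite linearPr linearPr.
Qed.

Lemma diagonal_traceN x : diagonal_trace (- x) = - diagonal_trace x.
Proof.
by rewrite -[- x]addr0 -scaleN1r diagonal_trace_linear /diagonal_trace
  [X in _ + X]big1 ?addr0 ?mulN1r// => k _; rewrite !linear0r.
Qed.

Lemma diagonal_trace0 : diagonal_trace 0 = 0.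
Proof. by rewrite /diagonal_trace big1// => k _; rewrite !linear0r. Qed.

Lemma diagonal_traceE (i j : 'I_n) : (i <= j)%N ->
  diagonal_trace (E i j) = phi (E i i) (E i j).
Proof.
move=> ij; rewrite /diagonal_trace (bigD1 i)//= EM// eqxx big1 ?addr0// => k ki.
by rewrite EM// (negPf ki) linear0r.
Qed.

Lemma phi_anticomm x y : phi x y = - phi y x.
Proof.
apply/eqP; rewrite -addr_eq0; apply/eqP.
have := phi0 (erefl ((x + y) *b (x + y))).
by rewrite linearDl !linearDr /= (phi0 (erefl (x *b x)))
  (phi0 (erefl (y *b y))) add0r addr0.
Qed.

(** The only pairs of units with a nonzero commutator are, up to order, the
    [(e_ij, e_jl)] with [i != l].  For [i < j < l], expand [phi] on the pair
    [(e_ii + e_ij, e_jl - e_il)], whose two products are both zero: of the four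
    terms, two vanish and the others give the claim.  For [j = l], use that
    [e_ii + e_jj] commutes with [e_ij]. *)
Lemma phi_composable_units (i j l : 'I_n) : (i <= j)%N -> (j <= l)%N -> i != l ->
  phi (E i j) (E j l) = phi (E i i) (E i l).
Proof.
move=> ij jl il; have li : l != i by rewrite eq_sym.
have le_il := leq_trans ij jl.
have [-> //|nij] := eqVneq i j.
have nji : j != i by rewrite eq_sym.
have [<-|_] := eqVneq j l.
  have : phi (E i i + E j j) (E i j) = 0.
    apply: phi0; rewrite linearDl linearDr /= !EM// !eqxx (negPf nji).
    by rewrite addr0 add0r.
  rewrite linearDl /= => /eqP; rewrite addr_eq0 => /eqP ->.
  by rewrite phi_anticomm.
have : phi (E i i + E i j) (E j l - E i l) = 0.
  apply: phi0; rewrite !(linearDl, linearDr, linearNl, linearNr) /= !EM//.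
  rewrite !eqxx (negPf nij) (negPf nji) (negPf li).
  by rewrite oppr0 !addr0 add0r addNr.
rewrite linearDl /= !linearBr /=.
rewrite [phi (E i i) (E j l)]phi0; last first.
  by rewrite !EM// (negPf nij) (negPf li).
rewrite [phi (E i j) (E i l)]phi0; last first.
  by rewrite !EM// (negPf nji) (negPf li).
by rewrite sub0r subr0 => /eqP; rewrite addrC subr_eq0 => /eqP.
Qed.

Lemma phi_units_commutator (i j k l : 'I_n) : (i <= j)%N -> (k <= l)%N ->
  phi (E i j) (E k l) = diagonal_trace (commutator (E i j) (E k l)).
Proof.
move=> ij kl; rewrite /commutator.
have [jk|njk] := eqVneq j k; have [li|nli] := eqVneq l i.
(* If both products of the two units are nonzero, the cycle
   [i <= j = k <= l = i] collapses all four indices. *)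
- have ji : j = i by apply/val_inj/anti_leq; rewrite ij -li jk kl.
  have kj : k = i by rewrite -jk.
  by rewrite ji kj li subrr diagonal_trace0 phi0.
- subst k; rewrite !EM// eqxx (negPf nli) subr0 diagonal_traceE; last first.
    exact: leq_trans kl.
  by rewrite phi_composable_units// eq_sym.
- subst l; rewrite !EM// eqxx (negPf njk) sub0r diagonal_traceN.
  rewrite diagonal_traceE; last exact: leq_trans ij.
  by rewrite phi_anticomm phi_composable_units// eq_sym.
- rewrite !EM// (negPf nli) (negPf njk) subrr diagonal_trace0 phi0//.
  by rewrite !EM// (negPf nli) (negPf njk).
Qed.

Lemma phi_span_commutator x y : triangular_span E x -> triangular_span E y ->
  phi x y = diagonal_trace (commutator x y).
Proof.
move=> xE yE; apply/eqP; rewrite -subr_eq0; apply/eqP.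
move: x y xE yE; apply: bilinear_eq0_triangular_span.
- move=> y a x x'; rewrite !linearPl /= diagonal_trace_linear.
  by rewrite mulrBr opprD addrACA.
- move=> x a y y'; rewrite !linearPr /= diagonal_trace_linear.
  by rewrite mulrBr opprD addrACA.
- by move=> i j k l ij kl; rewrite phi_units_commutator// subrr.
Qed.

(** The bound is independent of the number of units, which is what allows a
    passage to the limit. *)
Lemma norm_diagonal_trace_le M z :
  contractive_signs E -> 0 <= M ->
  (forall x y, `|phi x y| <= M * (`|x| * `|y|)) ->
  `|diagonal_trace z| <= M * `|z|.
Proof.
move=> Es M0 phiM.
have := @norm_diag_le_sign_sums K A phi (M * `|z|) n (fun k => E k k)
  (fun k => E k k *b z) 0 0 0.
rewrite linear0l !add0r; apply=> s; rewrite !add0r.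
under [X in phi _ X]eq_bigr do rewrite bscaleAl.
rewrite -linear_sumlz /=; set S := \sum_k _.
have S1 : `|S| <= 1 by exact: Es.
apply: le_trans (phiM _ _) _; rewrite ler_wpM2l//.
rewrite -[leRHS]mul1r ler_pM// (le_trans (normr_bmul_le _ _))//.
by rewrite -[leRHS]mul1r ler_wpM2r.
Qed.

End TriangularUnits.

(** * From the estimate to the functional *)

Section DominatedByCommutators.
Variables (K : numFieldType) (A : banachAlgType K) (phi : {biscalar A}).

(** Two expressions of the same element as a combination of commutators differ by
    a combination equal to 0, on which the bound makes the corresponding values
    of [phi] cancel; so [tau] is well defined. *)
Lemma functional_of_commutator_bound (M : K) :
  (forall n (a : 'I_n -> K) (x y : 'I_n -> A),
    `|\sum_i a i * phi (x i) (y i)|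
      <= M * `|\sum_i a i *: commutator (x i) (y i)|) ->
  exists tau : A -> K, linear_functional_on (@commutator_span K A) tau /\
    forall x y, phi x y = tau (commutator x y).
Proof.
move=> H.
(* [R] is the graph of [tau]. *)
pose R z c := exists n (a : 'I_n -> K) (x y : 'I_n -> A),
  z = \sum_i a i *: commutator (x i) (y i) /\ c = \sum_i a i * phi (x i) (y i).
have R_lin b z c z' c' : R z c -> R z' c' -> R (b *: z + z') (b * c + c').
  move=> [n [a [x [y [-> ->]]]]] [m [a' [x' [y' [-> ->]]]]].
  pose cat T (f : 'I_n -> T) (g : 'I_m -> T) (i : 'I_(n + m)) :=
    match fintype.split i with inl j => f j | inr j => g j end.
  exists (n + m)%N, (cat K (fun i => b * a i) a'), (cat A x x'), (cat A y y').
  have cl T f g j : cat T f g (lshift m j) = f j.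
    by rewrite /cat; case: splitP => [k|k] /= e; [congr f; exact: val_inj|
       move: (ltn_ord j); rewrite e ltnNge leq_addr].
  have cr T f g j : cat T f g (rshift n j) = g j.
    rewrite /cat; case: splitP => [k|k] /= e.
      by move: (ltn_ord k); rewrite -e ltnNge leq_addr.
    by congr g; apply: val_inj; apply/(addnI (esym e)).
  split; rewrite big_split_ord /=; congr (_ + _).
  - by rewrite scaler_sumr; apply: eq_bigr => i _; rewrite !cl scalerA.
  - by apply: eq_bigr => i _; rewrite !cr.
  - by rewrite mulr_sumr; apply: eq_bigr => i _; rewrite !cl mulrA.
  - by apply: eq_bigr => i _; rewrite !cr.
have R_fun z c c' : R z c -> R z c' -> c = c'.
  move=> zc zc'; have [n [a [x [y [e1 e2]]]]] := R_lin (-1) _ _ _ _ zc zc'.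
  have := H n a x y; rewrite -e1 -e2 scaleN1r addNr normr0 mulr0 normr_le0.
  by rewrite mulN1r addrC subr_eq0 => /eqP.
have [tau tauP] : exists tau : A -> K, forall z c, R z c -> tau z = c.
  have /choice[tau tauP] : forall z, exists c, forall c', R z c' -> c = c'.
    move=> z; have [[c zc]|noR] := pselect (exists c, R z c).
      by exists c => c'; apply: R_fun.
    by exists 0 => c zc; case: noR; exists c.
  by exists tau => z c; apply: tauP.
have R_span z : commutator_span z -> exists c, R z c.
  move=> [n [a [x [y ->]]]].
  by exists (\sum_i a i * phi (x i) (y i)), n, a, x, y.
exists tau; split=> [b z z' /R_span[c zc] /R_span[c' zc']|x y].
  by rewrite (tauP _ _ zc) (tauP _ _ zc') (tauP _ _ (R_lin b _ _ _ _ zc zc')).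
apply/esym/tauP; exists 1%N, (fun=> 1), (fun=> x), (fun=> y).
by rewrite !big_ord1 scale1r mul1r.
Qed.

End DominatedByCommutators.

(** * Passage to the limit *)

Section Density.
Variables (K : numFieldType) (A : banachAlgType K).
Variables (N : nat -> nat) (E : forall r, 'I_(N r) -> 'I_(N r) -> A).

(** What the argument uses of a triangular UHF algebra. The matrix units of one
    stage are sums of matrix units of the next; only the inclusion of the spans
    matters, so the embeddings themselves do not appear. *)
Definition triangular_exhaustion : Prop :=
  [/\ forall r, triangular_units (@E r),
      forall r, contractive_signs (@E r),
      forall q r, (q <= r)%N ->
        triangular_span (@E q) `<=` triangular_span (@E r)
    & forall (x : A) (e : K), 0 < e ->
        exists r, exists2 y, triangular_span (@E r) y & `|x - y| < e].

Lemma zero_Lie_product_determined_of_exhaustion :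
  triangular_exhaustion -> zero_Lie_product_determined A.
Proof.
move=> [EM Es Emono Edense] phi phi_cont phi0.
have [M M0 phiM] := continuous_biscalar_bounded phi_cont.
have comM (x y : A) : `|commutator x y| <= 2 * (`|x| * `|y|).
  rewrite mulr2n mulrDl mul1r (le_trans (ler_normB _ _))// lerD//.
    exact: normr_bmul_le.
  by rewrite (le_trans (normr_bmul_le _ _))// mulrC.
apply: (@functional_of_commutator_bound _ _ _ M) => n a x y.
(* The bound passes to limits, so approximate all x i and y i from the dense
   union; the union being directed, one E r contains all approximants.
   Over an ordered field that need not be archimedean, sequences do not suffice
   to approximate; the filter of small positive [d] does. *)
have approx (z : A) : exists u : K -> A * nat,
    (forall d, triangular_span (@E (u d).2) (u d).1) /\
    (u d).1 @[d --> 0^'+] --> z.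
  have /choice[u uP] (d : K) : exists u : A * nat,
      triangular_span (@E u.2) u.1 /\ (0 < d -> `|z - u.1| < d).
    have [d0|nd0] := boolP (0 < d).
      by have [r [v vE vz]] := Edense z d d0; exists (v, r).
    by have [r [v vE _]] := Edense z 1 ltr01; exists (v, r).
  exists u; split=> [d|]; first by case: (uP d).
  apply/cvgrPdist_lt => e e0; near=> d.
  apply: (@lt_trans _ _ d); last by near: d; exact: nbhs_right_lt.
  by apply: (uP d).2; near: d; exact: nbhs_right_gt.
have /choice[u uP] i := approx (x i).
have /choice[v vP] i := approx (y i).
have bound k : `|\sum_i a i * phi (u i k).1 (v i k).1|
    <= M * `|\sum_i a i *: commutator (u i k).1 (v i k).1|.
  pose r := \max_i maxn (u i k).2 (v i k).2.
  have uE i : triangular_span (@E r) (u i k).1.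
    apply: (@Emono (u i k).2); last exact: (uP i).1.
    by apply: leq_trans (leq_bigmax i); exact: leq_maxl.
  have vE i : triangular_span (@E r) (v i k).1.
    apply: (@Emono (v i k).2); last exact: (vP i).1.
    by apply: leq_trans (leq_bigmax i); exact: leq_maxr.
  under eq_bigr do rewrite (phi_span_commutator (EM r) phi0)//.
  have -> : \sum_i a i * diagonal_trace (@E r) phi
      (commutator (u i k).1 (v i k).1) =
      diagonal_trace (@E r) phi (\sum_i a i *: commutator (u i k).1 (v i k).1).
    elim/big_rec2: _ => [|i c z _ ->]; first by rewrite diagonal_trace0.
    by rewrite diagonal_trace_linear.
  exact: norm_diagonal_trace_le.
apply: (@cvg_norm_le _ K A M _ _ (at_right_proper_filter 0) _ _ _ _ M0 bound).
  apply: cvg_big => [|i _]; first exact: add_continuous.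
  apply: cvgMl_tmp.
  exact: (bounded_bilinear_cvg _ M0 phiM (uP i).2 (vP i).2).
apply: cvg_big => [|i _]; first exact: add_continuous.
apply: cvgZl_tmp.
exact: (bounded_bilinear_cvg _ (ler0n _ _) comM (uP i).2 (vP i).2).
Unshelve. all: by end_near. Qed.

End Density.

(** * Upper triangular matrices and diagonal sign matrices *)

Section TriangularMatrices.
Variable R : realType.
Local Notation C := (Cplx R).

Lemma upper_trigP n (x : 'M[C]_n) :
  reflect (forall i j : 'I_n, (j < i)%N -> x i j = 0) (upper_trig x).
Proof.
by apply: (iffP is_trig_mxP) => H i j ij; have := H j i ij; rewrite mxE.
Qed.

Lemma upper_trig0 n : upper_trig (0 : 'M[C]_n).
Proof. by apply/upper_trigP => i j _; rewrite mxE. Qed.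

Lemma upper_trigD n (x y : 'M[C]_n) :
  upper_trig x -> upper_trig y -> upper_trig (x + y).
Proof.
move=> /upper_trigP xP /upper_trigP yP; apply/upper_trigP => i j ij.
by rewrite mxE xP ?yP ?addr0.
Qed.

Lemma upper_trigZ n (a : C) (x : 'M[C]_n) : upper_trig x -> upper_trig (a *: x).
Proof.
by move=> /upper_trigP xP; apply/upper_trigP => i j ij; rewrite mxE xP ?mulr0.
Qed.

Lemma upper_trig_sum n (I : finType) (P : pred I) (x : I -> 'M[C]_n) :
  (forall i, P i -> upper_trig (x i)) -> upper_trig (\sum_(i | P i) x i).
Proof.
move=> xT; elim/big_ind: _ => //; first exact: upper_trig0.
by move=> y z; exact: upper_trigD.
Qed.

Lemma upper_trig_delta n (i j : 'I_n) :
  (i <= j)%N -> upper_trig (delta_mx i j : 'M[C]_n).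
Proof.
move=> ij; apply/upper_trigP => k l lk; rewrite mxE.
by case: andP => // -[/eqP ki /eqP lj]; move: lk; rewrite ki lj ltnNge ij.
Qed.

Lemma upper_trig_sum_delta n (x : 'M[C]_n) : upper_trig x ->
  x = \sum_(i < n) \sum_(j < n | (i <= j)%N) x i j *: delta_mx i j.
Proof.
move=> /upper_trigP xP; rewrite [LHS]matrix_sum_delta; apply: eq_bigr => i _.
rewrite (bigID (fun j : 'I_n => (i <= j)%N)) /= [X in _ + X]big1 ?addr0// => j.
by rewrite -ltnNge => ji; rewrite xP// scale0r.
Qed.

Lemma sigmaE (p q : nat) (pq : (p %| q)%N) (x : 'M[C]_p) (i j : 'I_q) :
  let k := mxtens_unindex (cast_ord (esym (divnK pq)) i) in
  let l := mxtens_unindex (cast_ord (esym (divnK pq)) j) in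
  sigma pq x i j = (k.1 == l.1)%:R * x k.2 l.2.
Proof. by move=> k l; rewrite /sigma castmxE !mxE. Qed.

Lemma upper_trig_sigma (p q : nat) (pq : (p %| q)%N) (x : 'M[C]_p) :
  upper_trig x -> upper_trig (sigma pq x).
Proof.
move=> /upper_trigP xP; apply/upper_trigP => i j ji; rewrite sigmaE.
case: eqP => [ij|]; last by rewrite mul0r.
rewrite xP ?mulr0//=.
have {ij} /= ij := congr1 val ij.
by move: ji; rewrite {1}(divn_eq i p) {1}(divn_eq j p) ij ltn_add2l.
Qed.

Definition sign_mx n (s : 'I_n -> bool) : 'M[C]_n := diag_mx (\row_k (-1) ^+ s k).

Lemma sign_mxE n (s : 'I_n -> bool) :
  sign_mx s = \sum_k (-1) ^+ s k *: delta_mx k k.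
Proof.
by rewrite /sign_mx diag_mx_sum_delta; apply: eq_bigr => k _; rewrite mxE.
Qed.

Lemma upper_trig_sign_mx n (s : 'I_n -> bool) : upper_trig (sign_mx s).
Proof.
apply/upper_trigP => i j ji; rewrite !mxE.
by case: eqP ji => [->|]; rewrite ?ltnn// mulr0n.
Qed.

(** [I_d] tensor [s] repeats the signs of [s] periodically along the diagonal. *)
Lemma sigma_sign_mx (p q : nat) (pq : (p %| q)%N) (s : 'I_p -> bool) :
  exists t : 'I_q -> bool, sigma pq (sign_mx s) = sign_mx t.
Proof.
pose u (i : 'I_q) := mxtens_unindex (cast_ord (esym (divnK pq)) i).
exists (fun i => s (u i).2); apply/matrixP => i j.
rewrite sigmaE -/(u i) -/(u j) !mxE.
have [->|ij] := eqVneq i j; first by rewrite !eqxx mul1r.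
rewrite mulr0n; case: (eqVneq (u i).1 (u j).1) => [e1|]; last by rewrite mul0r.
rewrite mul1r; case: (eqVneq (u i).2 (u j).2) => [e2|]; last by rewrite mulr0n.
have uE : u i = u j by rewrite [u i]surjective_pairing e1 e2 -surjective_pairing.
case/eqP: ij; apply: (@cast_ord_inj _ _ (esym (divnK pq))).
exact: (can_inj (@mxtens_unindexK _ _) uE).
Qed.

Lemma l2norm_sign_mx n (s : 'I_n -> bool) (v : 'cV[C]_n) :
  l2norm (sign_mx s *m v) = l2norm v.
Proof.
congr Num.sqrt; apply: eq_bigr => i _.
rewrite mul_diag_mx !mxE; case: (s i); last by rewrite mul1r.
by rewrite expr1 mulN1r !raddfN /= !sqrrN.
Qed.

Lemma opnorm_sign_mx_le1 n (s : 'I_n -> bool) : opnorm (sign_mx s) <= 1.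
Proof.
apply: ge_sup => [|_ [v v1 <-]]; last by rewrite l2norm_sign_mx.
exists (l2norm (sign_mx s *m 0)), 0 => //=; rewrite /l2norm big1 ?sqrtr0//.
by move=> i _; rewrite mxE /= expr0n addr0.
Qed.

(** The norm is a nonnegative complex number, hence has no imaginary part. *)
Lemma norm_le1_of_Re (V : normedModType C) (x : V) :
  complex.Re (`|x| : R[i]) <= 1 -> `|x| <= 1.
Proof.
have : 0 <= (`|x| : R[i]) by exact: normr_ge0.
move=> x0 x1.
suff: (`|x| : R[i]) <= 1 by [].
by rewrite lecE /= (ger0_Im x0) eqxx.
Qed.

End TriangularMatrices.

(** * Triangular UHF algebras *)

Section InductiveLimit.
Variables (R : realType) (p : nat -> nat).
Local Notation C := (Cplx R).
Variable dvd_p : forall m n, (m <= n)%N -> (p m %| p n)%N.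

Lemma inductive_limit_triangular_exhaustion (L : banachAlgType C) :
  is_inductive_limit dvd_p L ->
  exists E : forall r, 'I_(p r) -> 'I_(p r) -> L, triangular_exhaustion E.
Proof.
move=> [iota [iota_morph iota_sigma iota_norm iota_dense]].
have iota0 r : iota r 0 = 0.
  have := (iota_morph r (-1) 0 0 (upper_trig0 _ _) (upper_trig0 _ _)).1.
  by rewrite scaleN1r oppr0 addr0 scaleN1r addNr.
have iotaD r x y : upper_trig x -> upper_trig y ->
    iota r (x + y) = iota r x + iota r y.
  by move=> xT yT; have := (iota_morph r 1 x y xT yT).1; rewrite !scale1r.
have iotaZ r a x : upper_trig x -> iota r (a *: x) = a *: iota r x.
  move=> xT; have := (iota_morph r a x 0 xT (upper_trig0 _ _)).1.
  by rewrite iota0 !addr0.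
have iota_sum r (I : finType) (P : pred I) (x : I -> 'M[C]_(p r)) :
    (forall i, P i -> upper_trig (x i)) ->
    iota r (\sum_(i | P i) x i) = \sum_(i | P i) iota r (x i).
  move=> xT; suff [_ ->] : upper_trig (\sum_(i | P i) x i) /\
    iota r (\sum_(i | P i) x i) = \sum_(i | P i) iota r (x i) by [].
  elim/big_rec2: _ => [|i y z Pi [zT <-]].
    by split; [exact: upper_trig0|exact: iota0].
  by split; [apply: upper_trigD => //; exact: xT|rewrite iotaD//; exact: xT].
pose E r (i j : 'I_(p r)) := iota r (delta_mx i j : 'M[C]_(p r)).
have iotaE r x : upper_trig x ->
    iota r x = \sum_(i < p r) \sum_(j < p r | (i <= j)%N) x i j *: E r i j.
  have zT (i j : 'I_(p r)) : (i <= j)%N -> upper_trig (x i j *: delta_mx i j).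
    by move=> ij; apply/upper_trigZ/upper_trig_delta.
  move=> xT; rewrite {1}(upper_trig_sum_delta xT) iota_sum => [|i _]; last first.
    by apply: upper_trig_sum => j; exact: zT.
  apply: eq_bigr => i _; rewrite iota_sum => [|j]; last exact: zT.
  by apply: eq_bigr => j ij; rewrite iotaZ//; exact: upper_trig_delta.
have spanE r x : triangular_span (E r) x <->
    exists2 m, upper_trig m & x = iota r m.
  split=> [[a ->]|[m mT ->]]; last by exists m; exact: iotaE.
  (* The coefficients [a i j] with [j < i] are arbitrary: they are replaced by 0. *)
  pose m : 'M[C]_(p r) := \matrix_(i, j) if (i <= j)%N then a i j else 0.
  have mT : upper_trig m by apply/upper_trigP => i j ji; rewrite mxE leqNgt ji.
  exists m => //; rewrite iotaE//; apply: eq_bigr => i _.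
  by apply: eq_bigr => j ij; rewrite mxE ij.
exists E; split.
- move=> r i j k l ij kl.
  have := (iota_morph r 0 _ _ (upper_trig_delta R ij) (upper_trig_delta R kl)).2.
  rewrite /E => <-; rewrite mul_delta_mx_cond.
  by case: eqP => _; rewrite ?mulr1n// mulr0n iota0.
- move=> r s.
  have -> : \sum_k (-1) ^+ s k *: E r k k = iota r (sign_mx R s).
    have dT k : upper_trig (delta_mx k k : 'M[C]_(p r)) by exact: upper_trig_delta.
    rewrite sign_mxE iota_sum => [|k _]; last exact/upper_trigZ.
    by apply: eq_bigr => k _; rewrite iotaZ.
  apply: norm_le1_of_Re.
  (* The norm of the image is the limit of the operator norms of the later copies
     of the matrix, all of which are diagonal sign matrices. *)
  have cv := iota_norm r _ (upper_trig_sign_mx R s).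
  rewrite -(cvg_lim _ cv)//; apply: limr_le.
    by apply/cvg_ex; eexists; exact: cv.
  apply: nearW => k; have [t ->] := sigma_sign_mx R (dvd_p (leq_addr k r)) s.
  exact: opnorm_sign_mx_le1.
- move=> q r qr x /spanE[m mT ->]; apply/spanE.
  exists (sigma (dvd_p qr) m); first exact: upper_trig_sigma.
  by rewrite iota_sigma.
- move=> x e e0.
  have [|y [/= ye [r [m [mT yE]]]]] := iota_dense (ball x e) _ (ball_open x e).
    by exists x; exact: ballxx.
  exists r, (iota r m); first by apply/spanE; exists m.
  by rewrite -yE; move: ye; rewrite -ball_normE.
Qed.

End InductiveLimit.

Lemma isometric_triangular_exhaustion (K : numFieldType)
    (L A : banachAlgType K) (N : nat -> nat)
    (E : forall r, 'I_(N r) -> 'I_(N r) -> L) :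
  isometrically_isomorphic L A -> triangular_exhaustion E ->
  exists E' : forall r, 'I_(N r) -> 'I_(N r) -> A, triangular_exhaustion E'.
Proof.
move=> [f [[g fK gK] fM f_norm]] [EM Es Emono Edense].
pose E' r i j := f (E r i j).
have spanE r x : triangular_span (E' r) x <-> triangular_span (E r) (g x).
  have fE (a : 'I_(N r) -> 'I_(N r) -> K) :
      f (\sum_(i < N r) \sum_(j < N r | (i <= j)%N) a i j *: E r i j) =
      \sum_(i < N r) \sum_(j < N r | (i <= j)%N) a i j *: E' r i j.
    rewrite linear_sum; apply: eq_bigr => i _; rewrite linear_sum.
    by apply: eq_bigr => j _; rewrite linearZ.
  split=> [[a ->]|[a xE]]; exists a; first by rewrite -fE fK.
  by rewrite -fE -xE gK.
exists E'; split.
- by move=> r i j k l ij kl; rewrite /E' -fM EM//; case: eqP; rewrite ?linear0.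
- move=> r s; have -> : \sum_k (-1) ^+ s k *: E' r k k =
      f (\sum_k (-1) ^+ s k *: E r k k).
    by rewrite linear_sum; apply: eq_bigr => k _; rewrite linearZ.
  by rewrite f_norm; exact: Es.
- by move=> q r qr x /spanE xE; apply/spanE; exact: Emono xE.
- move=> x e e0; have [r [y yE xy]] := Edense (g x) e e0.
  exists r, (f y); first by apply/spanE; rewrite fK.
  by rewrite -{1}(gK x) -linearB f_norm.
Qed.

Theorem theorem5 (R : realType) (A : banachAlgType (Cplx R)) :
  triangular_UHF A -> zero_Lie_product_determined A.
Proof.
move=> [p [dvd_p [L [_ Llim LA]]]].
have [E EL] := inductive_limit_triangular_exhaustion Llim.
have [E' E'A] := isometric_triangular_exhaustion LA EL.
exact: zero_Lie_product_determined_of_exhaustion E'A.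
Qed.
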